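(* A transversal for the action of $SO_3$ on $\mathbb S^3\times\mathbb S^3$ is given by $$M=(\{\pm1\}\times\{\pm1\})\cup(\{\pm1\}\times P_0)\cup(P_0\times\{\pm1\})\cup(P_0\times P).$$
   Context: $\mathbb S^3$ is the set of norm one elements of the quaternion algebra $\mathbb H$, and $(u,v)$ is a fixed orthonormal pair in $\mathbb H\cap1^\perp$. $SO_3$ is identified with $\{\kappa_q\mid q\in\mathbb S^3\}$, where $\kappa_q:\mathbb H\to\mathbb H$, $x\mapsto qx\overline q$, and it acts on $\mathbb S^3\times\mathbb S^3$ by $\kappa_q\cdot(a,b)=(\kappa_q(a),\kappa_q(b))$. Set $$P=\{\cos\alpha+(u\cos\beta+v\sin\beta)\sin\alpha\mid\alpha\in(0,\pi),\ \beta\in[0,\pi]\},\qquad P_0=\{\cos\alpha+u\sin\alpha\mid\alpha\in(0,\pi)\}.$$ A transversal for an action is a subset containing exactly one element of each orbit. *)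

(* Defs.v *)
From HB Require Import structures.
From mathcomp Require Import all_boot all_order all_algebra.
From mathcomp Require Import ring.
From mathcomp Require Import boolp classical_sets set_interval reals trigo.

Set Implicit Arguments.
Unset Strict Implicit.
Unset Printing Implicit Defensive.

Import Order.TTheory GRing.Theory Num.Theory.

Local Open Scope classical_set_scope.
Local Open Scope ring_scope.

(* [Quat a b c d] is a + b i + c j + d k. *)
Record quat (R : Type) : Type := Quat { quat_re : R; quat_i : R; quat_j : R; quat_k : R }.

Section QuaternionAlgebra.
Variable R : comNzRingType.
Local Notation H := (quat R).
Implicit Types (x y z : H) (a b : R).

Definition prod_of_quat x : R * R * R * R :=
  (quat_re x, quat_i x, quat_j x, quat_k x).
Definition quat_of_prod (p : R * R * R * R) : H :=
  Quat p.1.1.1 p.1.1.2 p.1.2 p.2.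
Lemma prod_of_quatK : cancel prod_of_quat quat_of_prod.
Proof. by case. Qed.
HB.instance Definition _ := Choice.copy H (can_type prod_of_quatK).

Definition quat_zero : H := Quat 0 0 0 0.
Definition quat_opp x :=
  Quat (- quat_re x) (- quat_i x) (- quat_j x) (- quat_k x).
Definition quat_add x y :=
  Quat (quat_re x + quat_re y) (quat_i x + quat_i y)
       (quat_j x + quat_j y) (quat_k x + quat_k y).

Lemma quat_addA : associative quat_add.
Proof. by move=> [????] [????] [????]; congr Quat; apply: addrA. Qed.
Lemma quat_addC : commutative quat_add.
Proof. by move=> [????] [????]; congr Quat; apply: addrC. Qed.
Lemma quat_add0 : left_id quat_zero quat_add.
Proof. by move=> [????]; congr Quat; apply: add0r. Qed.
Lemma quat_addN : left_inverse quat_zero quat_opp quat_add.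
Proof. by move=> [????]; congr Quat; apply: addNr. Qed.
HB.instance Definition _ :=
  GRing.isZmodule.Build H quat_addA quat_addC quat_add0 quat_addN.

Definition quat_one : H := Quat 1 0 0 0.
Definition quat_mul x y :=
  let: Quat x0 x1 x2 x3 := x in let: Quat y0 y1 y2 y3 := y in
  Quat (x0 * y0 - x1 * y1 - x2 * y2 - x3 * y3)
       (x0 * y1 + x1 * y0 + x2 * y3 - x3 * y2)
       (x0 * y2 - x1 * y3 + x2 * y0 + x3 * y1)
       (x0 * y3 + x1 * y2 - x2 * y1 + x3 * y0).

Lemma quat_mulA : associative quat_mul.
Proof. by move=> [????] [????] [????]; congr Quat; ring. Qed.
Lemma quat_mul1l : left_id quat_one quat_mul.
Proof. by move=> [????]; congr Quat; ring. Qed.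
Lemma quat_mul1r : right_id quat_one quat_mul.
Proof. by move=> [????]; congr Quat; ring. Qed.
Lemma quat_mulDl : left_distributive quat_mul quat_add.
Proof. by move=> [????] [????] [????]; congr Quat; rewrite /=; ring. Qed.
Lemma quat_mulDr : right_distributive quat_mul quat_add.
Proof. by move=> [????] [????] [????]; congr Quat; rewrite /=; ring. Qed.
Lemma quat_oner_neq0 : quat_one != 0.
Proof. by apply/eqP => -[/eqP]; rewrite oner_eq0. Qed.
HB.instance Definition _ := GRing.Zmodule_isNzRing.Build H
  quat_mulA quat_mul1l quat_mul1r quat_mulDl quat_mulDr quat_oner_neq0.

Definition quat_scale a x :=
  Quat (a * quat_re x) (a * quat_i x) (a * quat_j x) (a * quat_k x).

Lemma quat_scaleA a b x : quat_scale a (quat_scale b x) = quat_scale (a * b) x.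
Proof. by congr Quat; apply: mulrA. Qed.
Lemma quat_scale1 : left_id 1 quat_scale.
Proof. by move=> [????]; congr Quat; apply: mul1r. Qed.
Lemma quat_scaleDr : right_distributive quat_scale +%R.
Proof. by move=> a [????] [????]; congr Quat; apply: mulrDr. Qed.
Lemma quat_scaleDl x : {morph quat_scale^~ x : a b / a + b}.
Proof. by move=> a b; congr Quat; apply: mulrDl. Qed.
HB.instance Definition _ := GRing.Zmodule_isLmodule.Build R H
  quat_scaleA quat_scale1 quat_scaleDr quat_scaleDl.

Lemma quat_scaleAl a x y : a *: (x * y) = (a *: x) * y.
Proof. by case: x y => [????] [????]; congr Quat; rewrite /=; ring. Qed.
HB.instance Definition _ := GRing.Lmodule_isLalgebra.Build R H quat_scaleAl.
Lemma quat_scaleAr a x y : a *: (x * y) = x * (a *: y).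
Proof. by case: x y => [????] [????]; congr Quat; rewrite /=; ring. Qed.
HB.instance Definition _ := GRing.Lalgebra_isAlgebra.Build R H quat_scaleAr.

Definition quat_conj x : H :=
  Quat (quat_re x) (- quat_i x) (- quat_j x) (- quat_k x).

Definition quat_dot x y : R :=
  quat_re x * quat_re y + quat_i x * quat_i y
  + quat_j x * quat_j y + quat_k x * quat_k y.

Definition kappa (q x : H) : H := q * x * quat_conj q.

Lemma quat_conjM x y : quat_conj (x * y) = quat_conj y * quat_conj x.
Proof. by case: x y => [????] [????]; congr Quat; rewrite /=; ring. Qed.

Lemma kappaM p q x : kappa (p * q) x = kappa p (kappa q x).
Proof. by rewrite /kappa quat_conjM !mulrA. Qed.

Lemma kappa1 x : kappa 1 x = x.
Proof. by case: x => [????]; congr Quat; rewrite /=; ring. Qed.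

Lemma quat_mul_conj x : x * quat_conj x = (quat_dot x x)%:A.
Proof. by case: x => [????]; congr Quat; rewrite /= /quat_dot /=; ring. Qed.

Lemma quat_dotM x y :
  quat_dot (x * y) (x * y) = quat_dot x x * quat_dot y y.
Proof. by case: x y => [????] [????]; rewrite /quat_dot /=; ring. Qed.

End QuaternionAlgebra.

Section Action.
Variables (G T : Type) (act : G -> T -> T).

Definition action_orbit (A : set G) (x : T) : set T := [set act g x | g in A].

(* Exactly one element of M in each A-orbit of the A-stable set X. *)
Definition action_transversal (A : set G) (X M : set T) : Prop :=
  M `<=` X /\ forall x, X x -> exists! m, (M `&` action_orbit A x) m.

End Action.

Section Sphere.
Variable R : realType.
Local Notation H := (quat R).

Definition quat_norm (x : H) : R := Num.sqrt (quat_dot x x).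

Definition S3 : set H := [set x | quat_norm x = 1].

Definition SO3 : set (H -> H) := [set kappa q | q in S3].

Lemma S3E (x : H) : S3 x <-> quat_dot x x = 1.
Proof.
rewrite /S3 /= /quat_norm; split=> [h|->]; last exact: sqrtr1.
have x_ge0 : 0 <= quat_dot x x.
  by rewrite /quat_dot -!expr2 !addr_ge0 ?sqr_ge0.
by rewrite -(sqr_sqrtr x_ge0) h expr1n.
Qed.

Lemma SO3_S3 g x : SO3 g -> S3 x -> S3 (g x).
Proof.
move=> [q /S3E qq <-] /S3E xx; apply/S3E; rewrite !quat_dotM qq xx !mul1r.
by rewrite -qq /quat_dot /= !mulrNN.
Qed.

Definition diag_act (g : H -> H) (p : H * H) : H * H := (g p.1, g p.2).

Definition orth1 : set H := [set x | quat_dot x 1 = 0].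

Definition orthonormal_pair (u v : H) : Prop :=
  [/\ quat_norm u = 1, quat_norm v = 1 & quat_dot u v = 0].

Definition P_set (u v : H) : set H :=
  [set (cos a)%:A + sin a *: (cos b *: u + sin b *: v)
     | a in `]0, pi[ & b in `[0, pi]].

Definition P0_set (u : H) : set H :=
  [set (cos a)%:A + sin a *: u | a in `]0, pi[].

Definition M_set (u v : H) : set (H * H) :=
  ([set 1; -1] `*` [set 1; -1]) `|` ([set 1; -1] `*` P0_set u)
  `|` (P0_set u `*` [set 1; -1]) `|` (P0_set u `*` P_set u v).

End Sphere.

Arguments S3 : clear implicits.
Arguments SO3 : clear implicits.
Arguments orth1 : clear implicits.

(* Main.v *)
Require Import Defs.
From mathcomp Require Import all_boot all_order all_algebra.
From mathcomp Require Import ring.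
From mathcomp Require Import classical_sets reals trigo.

(** For a unit quaternion [q], [kappa q] is an isometry fixing the real axis,
    so the real parts of [x] and [y] and the inner product of [x] with [y]
    are constant on the orbit of a pair [(x, y)].  Both halves of the theorem
    are read off a coordinate description of [M_set u v]
    ([M_set_normal_form] and [M_set_normal_formP]): it consists of the pairs
    of unit quaternions [(c + s u, d + p u + t v)] with [s, t >= 0] where, in
    the degenerate case [s = 0], moreover [p >= 0] and [t = 0].

    Each orbit meets [M_set u v] ([exists_normal_form]).  First rotate the
    imaginary part of [x] to [s u] with [s >= 0].  If [s > 0], rotate about
    the axis [u], which does not disturb [s u], until the part of [y]
    orthogonal to [1] and [u] is [t v] with [t >= 0].  If [s = 0], the first
    component is real, hence fixed by every rotation, and the imaginary part
    of [y] can be rotated to [p u] with [p >= 0].  The rotations used come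
    from [rotate_unit]: for imaginary unit quaternions [x] and [y] the element
    [1 - y x] intertwines [x] with [y], so its normalisation rotates [x] to
    [y], and it commutes with every imaginary [w] orthogonal to both.

    Each orbit meets [M_set u v] only once ([M_set_inj]).  The invariants of
    a pair in coordinates are [c], [d] and [c d + s p]; they determine [s]
    from [c ^+ 2 + s ^+ 2 = 1], then [p] if [s > 0], and finally the one
    remaining coordinate, which is nonnegative, from
    [d ^+ 2 + p ^+ 2 + t ^+ 2 = 1]. *)

Set Implicit Arguments.
Unset Strict Implicit.
Unset Printing Implicit Defensive.

Import Order.TTheory GRing.Theory Num.Theory.

Local Open Scope classical_set_scope.
Local Open Scope ring_scope.

(** * The inner product, conjugation by unit quaternions, and anticommutation *)

Section Algebra.
Variable R : comNzRingType.
Local Notation H := (quat R).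
Implicit Types (x y z q : H) (a : R).

Lemma quat_dotC x y : quat_dot x y = quat_dot y x.
Proof. by rewrite /quat_dot; ring. Qed.

Lemma quat_dotDl x y z : quat_dot (x + y) z = quat_dot x z + quat_dot y z.
Proof. by rewrite /quat_dot /=; ring. Qed.

Lemma quat_dotZl a x y : quat_dot (a *: x) y = a * quat_dot x y.
Proof. by rewrite /quat_dot /=; ring. Qed.

Lemma quat_dotDr x y z : quat_dot z (x + y) = quat_dot z x + quat_dot z y.
Proof. by rewrite quat_dotC quat_dotDl !(quat_dotC z). Qed.

Lemma quat_dotZr a x y : quat_dot x (a *: y) = a * quat_dot x y.
Proof. by rewrite quat_dotC quat_dotZl quat_dotC. Qed.

Lemma quat_dot11 : quat_dot 1 1 = 1 :> R.
Proof. by rewrite /quat_dot /=; ring. Qed.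

Lemma kappaD q x y : kappa q (x + y) = kappa q x + kappa q y.
Proof. by rewrite /kappa mulrDr mulrDl. Qed.

Lemma kappaZ q a x : kappa q (a *: x) = a *: kappa q x.
Proof. by rewrite /kappa -scalerAr -scalerAl. Qed.

Lemma kappa_of1 q : quat_dot q q = 1 -> kappa q 1 = 1.
Proof. by move=> qq; rewrite /kappa mulr1 quat_mul_conj qq scale1r. Qed.

(** [kappa q] is left and right multiplication by unit quaternions, and the
    norm is multiplicative, so [kappa q] is an isometry. *)
Lemma kappa_dot q x y :
  quat_dot q q = 1 -> quat_dot (kappa q x) (kappa q y) = quat_dot x y.
Proof.
move=> qq; transitivity (quat_dot q q ^+ 2 * quat_dot x y); last first.
  by rewrite qq expr1n mul1r.
by case: q x y {qq} => [????] [????] [????]; rewrite /quat_dot /kappa /=; ring.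
Qed.

(** [quat_dot x 1] is the real part of [x]. *)
Lemma kappa_dot1 q x :
  quat_dot q q = 1 -> quat_dot (kappa q x) 1 = quat_dot x 1.
Proof. by move=> qq; rewrite -{1}(kappa_of1 qq) kappa_dot. Qed.

Lemma kappa_intertwine q x y :
  quat_dot q q = 1 -> q * x = y * q -> kappa q x = y.
Proof. by move=> qq e; rewrite /kappa e -mulrA quat_mul_conj qq scale1r mulr1. Qed.

(** Polarisation of [x * x = - quat_dot x x] on imaginary quaternions:
    orthogonality there is anticommutation. *)
Lemma imag_anticomm x y : quat_dot x 1 = 0 -> quat_dot y 1 = 0 ->
  quat_dot x y = 0 -> x * y = - (y * x).
Proof.
case: x y => [x0 x1 x2 x3] [y0 y1 y2 y3]; rewrite /quat_dot /= !mulr0 !addr0 !mulr1.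
move=> -> ->; rewrite mul0r add0r => e; congr Quat => /=.
- transitivity (- (x1 * y1 + x2 * y2 + x3 * y3)); first by ring.
  by transitivity (x1 * y1 + x2 * y2 + x3 * y3); [rewrite e oppr0 | ring].
- by ring.
- by ring.
- by ring.
Qed.

Lemma imag_unit_sqr x : quat_dot x 1 = 0 -> quat_dot x x = 1 -> x * x = -1.
Proof.
case: x => [x0 x1 x2 x3]; rewrite /quat_dot /= !mulr0 !addr0 !mulr1.
move=> ->; rewrite mul0r add0r => e.
by congr Quat => /=; [rewrite -e; ring | ring..].
Qed.

Lemma quat_imagP x : exists2 y, quat_dot y 1 = 0 & x = (quat_dot x 1)%:A + y.
Proof.
exists (x - (quat_dot x 1)%:A); last by rewrite addrC subrK.
by rewrite quat_dotDl -scaleNr quat_dotZl quat_dot11 mulr1 subrr.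
Qed.

End Algebra.

Section Main.
Variable R : realType.
Local Notation H := (quat R).
Implicit Types (x y z q w u v : H) (a c s d p t : R).

(** * Rotations between imaginary quaternions *)

Lemma quat_dot_ge0 x : 0 <= quat_dot x x.
Proof. by rewrite /quat_dot -!expr2 !addr_ge0 ?sqr_ge0. Qed.

Lemma quat_dot_eq0 x : quat_dot x x = 0 -> x = 0.
Proof.
move: x => [x0 x1 x2 x3]; rewrite /quat_dot /= -!expr2 => /eqP.
by rewrite !paddr_eq0 ?addr_ge0 ?sqr_ge0// !sqrf_eq0
  => /andP[/andP[/andP[/eqP-> /eqP->] /eqP->] /eqP->].
Qed.

Lemma quat_normalize x : x != 0 ->
  exists2 t, 0 < t & exists2 y, quat_dot y y = 1 & x = t *: y.
Proof.
move=> x0; have t0 : 0 < quat_norm x.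
  rewrite sqrtr_gt0 lt_def quat_dot_ge0 andbT.
  by apply: contraNneq x0 => /quat_dot_eq0 ->.
exists (quat_norm x) => //; exists ((quat_norm x)^-1 *: x); last first.
  by rewrite scalerA divff ?scale1r// gt_eqF.
rewrite quat_dotZl quat_dotZr -[X in _ * (_ * X)]sqr_sqrtr ?quat_dot_ge0//.
by rewrite -/(quat_norm x); field; rewrite gt_eqF.
Qed.

(** As [x] and [y] both square to [-1], [(1 - y x) x = x + y = y (1 - y x)],
    so normalising [1 - y x] gives a rotation from [x] to [y] unless
    [y x = 1].  That exception is [x = - y], where the half turn about any
    axis [w] orthogonal to [y] does the job.  In both cases [w] is fixed as
    soon as it is orthogonal to [x] too: it anticommutes with [x] and [y],
    hence commutes with [y x]. *)
Lemma rotate_unit x y w :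
  quat_dot x 1 = 0 -> quat_dot x x = 1 ->
  quat_dot y 1 = 0 -> quat_dot y y = 1 ->
  quat_dot w 1 = 0 -> quat_dot w w = 1 -> quat_dot w y = 0 ->
  exists2 q, quat_dot q q = 1 &
    kappa q x = y /\ (quat_dot w x = 0 -> kappa q w = w).
Proof.
move=> x1 xx y1 yy w1 ww wy.
have xsq := imag_unit_sqr x1 xx; have ysq := imag_unit_sqr y1 yy.
have [q0|qN0] := eqVneq (1 - y * x) 0.
  have xNy : x = - y.
    move/eqP: q0; rewrite subr_eq0 => /eqP e.
    by rewrite -[y]mulr1 e mulrA ysq mulN1r opprK.
  exists w => //; split=> [|_]; apply: kappa_intertwine => //.
  by rewrite xNy mulrN (imag_anticomm w1 y1 wy) opprK.
have [t t0 [q qq eq]] := quat_normalize qN0.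
have qE : q = t^-1 *: (1 - y * x) by rewrite eq scalerA mulVf ?scale1r ?gt_eqF.
exists q => //; split=> [|wx]; apply: kappa_intertwine => //; rewrite qE.
  rewrite -scalerAl -scalerAr; congr (_ *: _).
  by rewrite mulrBl mulrBr -mulrA xsq mulrA ysq mul1r mulr1 mulrN1 mulN1r !opprK addrC.
rewrite -scalerAl -scalerAr; congr (_ *: _).
rewrite mulrBl mulrBr mul1r mulr1 mulrA (imag_anticomm w1 y1 wy) mulNr -!mulrA.
by rewrite (imag_anticomm w1 x1 wx) mulrN opprK.
Qed.

(** The scaled form of [rotate_unit]; taking [x = 0] into account here spares
    the degenerate pairs a separate treatment later on. *)
Lemma rotate_imag x y w :
  quat_dot x 1 = 0 -> quat_dot y 1 = 0 -> quat_dot y y = 1 ->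
  quat_dot w 1 = 0 -> quat_dot w w = 1 -> quat_dot w y = 0 ->
  exists2 q, quat_dot q q = 1 & exists2 t, 0 <= t &
    kappa q x = t *: y /\ (quat_dot w x = 0 -> kappa q w = w).
Proof.
move=> x1 y1 yy w1 ww wy; have [->|xN0] := eqVneq x 0.
  exists 1; first exact: quat_dot11.
  by exists 0 => //; rewrite scale0r !kappa1.
have [t t0 [z zz xE]] := quat_normalize xN0.
have z1 : quat_dot z 1 = 0.
  by move: x1; rewrite xE quat_dotZl => /eqP; rewrite mulf_eq0 gt_eqF//= => /eqP.
have [q qq [qz qw]] := rotate_unit z1 zz y1 yy w1 ww wy.
exists q => //; exists t; first exact: ltW.
rewrite xE kappaZ qz quat_dotZr; split=> // /eqP.
by rewrite mulf_eq0 gt_eqF//= => /eqP.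
Qed.

(** * Coordinates on the transversal *)

Lemma half_circle_closed c s : 0 <= s -> c ^+ 2 + s ^+ 2 = 1 ->
  exists2 a, a \in `[0, pi] & cos a = c /\ sin a = s.
Proof.
move=> s0 e.
have c1 : -1 <= c <= 1.
  rewrite -ler_norml -(@ler_pXn2r _ 2) ?nnegrE// expr1n.
  by rewrite real_normK ?num_real// -e lerDl exprn_ge0.
exists (acos c); first by rewrite in_itv /= acos_ge0 ?acos_lepi.
rewrite acosK// sin_acos//; split=> //.
by rewrite -e addrC addKr sqrtr_sqr ger0_norm.
Qed.

Lemma half_circle_open c s : 0 < s -> c ^+ 2 + s ^+ 2 = 1 ->
  exists2 a, a \in `]0, pi[ & cos a = c /\ sin a = s.
Proof.
move=> s0 /(half_circle_closed (ltW s0))[a]; rewrite in_itv /= => /andP[a0 api] [ca sa].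
exists a => //; rewrite in_itv /= !lt_def a0 api !andbT; apply/andP; split.
  by apply: contraTneq s0 => az; rewrite -sa az sin0 ltxx.
by apply: contraTneq s0 => az; rewrite -sa -az sinpi ltxx.
Qed.

Definition normal_form u v (c s d p t : R) : H * H :=
  (c%:A + s *: u, d%:A + p *: u + t *: v).

(** The clause for [s = 0] reflects that a real first component is fixed by
    all rotations, so that the whole imaginary part of the second one can be
    moved to the ray through [u]. *)
Definition normal_coords (c s d p t : R) :=
  [/\ 0 <= s, 0 <= t, s = 0 -> 0 <= p /\ t = 0,
     c ^+ 2 + s ^+ 2 = 1 & d ^+ 2 + p ^+ 2 + t ^+ 2 = 1].

Lemma pm1P c : c ^+ 2 = 1 -> [set 1; -1] (c%:A : H).
Proof.
move=> /eqP; rewrite sqrf_eq1 => /orP[]/eqP->.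
  by left; rewrite scale1r.
by right; rewrite scaleN1r.
Qed.

Lemma P0_setP u c s : 0 < s -> c ^+ 2 + s ^+ 2 = 1 -> P0_set u (c%:A + s *: u).
Proof. by move=> s0 /(half_circle_open s0)[a ai [<- <-]]; exists a. Qed.

(** [d] and the length [r] of the imaginary part are the cosine and sine of
    the first angle; the direction [(p / r, t / r)] of the imaginary part is
    given by the second. *)
Lemma P_setP u v d p t : 0 <= t -> 0 < p ^+ 2 + t ^+ 2 ->
  d ^+ 2 + p ^+ 2 + t ^+ 2 = 1 -> P_set u v (d%:A + p *: u + t *: v).
Proof.
move=> t0 r0 e; set r := Num.sqrt (p ^+ 2 + t ^+ 2).
have rgt0 : 0 < r by rewrite sqrtr_gt0.
have rE : r ^+ 2 = p ^+ 2 + t ^+ 2 by rewrite sqr_sqrtr// ltW.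
have [a ai [ca sa]] : exists2 a, a \in `]0, pi[ & cos a = d /\ sin a = r.
  by apply: half_circle_open; rewrite // rE addrA.
have [b bi [cb sb]] : exists2 b, b \in `[0, pi] & cos b = p / r /\ sin b = t / r.
  apply: half_circle_closed; first by rewrite divr_ge0// ltW.
  by rewrite !expr_div_n -mulrDl -rE divff// expf_neq0// gt_eqF.
exists a => //; exists b => //.
by rewrite ca sa cb sb scalerDr !scalerA !(mulrC r) !divfK ?gt_eqF// addrA.
Qed.

(** The four pieces of [M_set u v] correspond to whether [s] vanishes and
    whether the imaginary part [p u + t v] does. *)
Lemma M_set_normal_form u v c s d p t :
  normal_coords c s d p t -> M_set u v (normal_form u v c s d p t).
Proof.
move=> [s0 t0 hs e1 e2].
have [r0|rN0] := eqVneq (p ^+ 2 + t ^+ 2) 0.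
  have /andP[/eqP p0 /eqP tz] : (p == 0) && (t == 0).
    by move/eqP: r0; rewrite paddr_eq0 ?sqr_ge0// !sqrf_eq0.
  have d1 : d ^+ 2 = 1 by rewrite -e2 -addrA r0 addr0.
  rewrite /normal_form p0 tz !scale0r !addr0.
  have [sz|sN] := eqVneq s 0.
    rewrite sz scale0r addr0; left; left; left; split; apply: pm1P => //=.
    by rewrite -e1 sz expr0n addr0.
  left; right; split; last exact: pm1P.
  by apply: P0_setP; rewrite // lt_def sN.
have rgt0 : 0 < p ^+ 2 + t ^+ 2 by rewrite lt_def rN0 addr_ge0 ?sqr_ge0.
have [sz|sN] := eqVneq s 0; last first.
  by right; split; [apply: P0_setP; rewrite // lt_def sN | exact: P_setP].
have [p0 tz] := hs sz; rewrite /normal_form sz tz !scale0r !addr0.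
left; left; right; split; first by apply: pm1P; rewrite -e1 sz expr0n addr0.
apply: P0_setP; last by rewrite -e2 tz expr0n addr0.
by rewrite lt_def p0 andbT; apply: contraNneq rN0 => ->; rewrite tz expr0n addr0.
Qed.

Lemma M_set_normal_formP u v m : M_set u v m ->
  exists c s d p t, normal_coords c s d p t /\ m = normal_form u v c s d p t.
Proof.
have pm1 (x : H) : [set 1; -1] x -> exists2 c, c ^+ 2 = 1 & x = c%:A.
  by move=> [->|->]; [exists 1|exists (-1)]; rewrite ?scale1r ?scaleN1r ?sqrrN ?expr1n.
have P0 (x : H) : P0_set u x ->
    exists c s, [/\ 0 < s, c ^+ 2 + s ^+ 2 = 1 & x = c%:A + s *: u].
  move=> [a ai <-]; exists (cos a), (sin a); split=> //; last exact: cos2Dsin2.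
  by move: ai; rewrite /= in_itv /= => ai; exact: sin_gt0_pi.
case: m => x y [[[[/= X Y]|[/= X Y]]|[/= X Y]]|[/= X Y]].
- have [c c1 ->] := pm1 _ X; have [d d1 ->] := pm1 _ Y.
  exists c, 0, d, 0, 0; rewrite /normal_form !scale0r !addr0; split=> //.
  by split; rewrite // ?c1 ?d1 ?expr0n ?addr0.
- have [c c1 ->] := pm1 _ X; have [d [p [p0 e ->]]] := P0 _ Y.
  exists c, 0, d, p, 0; rewrite /normal_form !scale0r !addr0; split=> //.
  by split; rewrite // ?c1 ?expr0n ?addr0 //; split=> //; exact: ltW.
- have [c [s [s0 e ->]]] := P0 _ X; have [d d1 ->] := pm1 _ Y.
  exists c, s, d, 0, 0; rewrite /normal_form !scale0r !addr0; split=> //.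
  by split; rewrite // ?d1 ?expr0n ?addr0 // ltW.
- have [c [s [s0 e ->]]] := P0 _ X; case: Y => a ai [b bi <-].
  exists c, s, (cos a), (sin a * cos b), (sin a * sin b); split; last first.
    by rewrite /normal_form scalerDr !scalerA addrA.
  have sa0 : 0 < sin a by move: ai; rewrite /= in_itv /= => ai; exact: sin_gt0_pi.
  split=> //; first exact: ltW.
  + rewrite mulr_ge0 ?(ltW sa0)//; apply: sin_ge0_pi.
    by move: bi; rewrite /= in_itv.
  + by move=> sz; rewrite sz ltxx in s0.
  + by rewrite !exprMn -addrA -mulrDr cos2Dsin2 mulr1 cos2Dsin2.
Qed.

(** * Existence and uniqueness of the representative of an orbit *)

Section OrthonormalPair.
Variables u v : H.
Hypothesis u1 : quat_dot u 1 = 0.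
Hypothesis v1 : quat_dot v 1 = 0.
Hypothesis uu : quat_dot u u = 1.
Hypothesis vv : quat_dot v v = 1.
Hypothesis uv : quat_dot u v = 0.

Let ortho := (quat_dotDl, quat_dotDr, quat_dotZl, quat_dotZr, quat_dot11,
  (quat_dotC 1 u), (quat_dotC 1 v), (quat_dotC v u), u1, v1, uu, vv, uv,
  mulr0, mulr1, addr0, add0r).

Lemma normal_form_invariants c s d p t (m := normal_form u v c s d p t) :
  [/\ quat_dot m.1 1 = c, quat_dot m.2 1 = d,
     quat_dot m.1 m.2 = c * d + s * p,
     quat_dot m.1 m.1 = c ^+ 2 + s ^+ 2 &
     quat_dot m.2 m.2 = d ^+ 2 + p ^+ 2 + t ^+ 2].
Proof. by rewrite /m /= !ortho; split=> //; ring. Qed.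

(** The three invariants separate the points of [M_set u v].  When [s = 0]
    the inner product carries no information on [p], but then [t = 0], and
    [p] is the nonnegative root of [1 - d ^+ 2]. *)
Lemma M_set_inj m m' : M_set u v m -> M_set u v m' ->
  quat_dot m.1 1 = quat_dot m'.1 1 -> quat_dot m.2 1 = quat_dot m'.2 1 ->
  quat_dot m.1 m.2 = quat_dot m'.1 m'.2 -> m = m'.
Proof.
move=> /M_set_normal_formP[c [s [d [p [t [[s0 t0 hs e1 e2] ->]]]]]].
move=> /M_set_normal_formP[c' [s' [d' [p' [t' [[s0' t0' hs' e1' e2'] ->]]]]]].
have [-> -> -> _ _] := normal_form_invariants c s d p t.
have [-> -> -> _ _] := normal_form_invariants c' s' d' p' t'.
move=> cc dd; rewrite {}cc {}dd in e1 e2 *; move=> /addrI sp.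
have sqr_inj (a b : R) : 0 <= a -> 0 <= b -> a ^+ 2 = b ^+ 2 -> a = b.
  by move=> a0 b0 /eqP; rewrite eqrXn2// => /eqP.
have ss : s = s' by apply: sqr_inj => //; apply: (addrI (c' ^+ 2)); rewrite e1 e1'.
rewrite {s s0}ss in hs e1 sp *.
suff [-> ->] : p = p' /\ t = t' by [].
have [sz|sN] := eqVneq s' 0.
  have [p0 tz] := hs sz; have [p0' tz'] := hs' sz.
  split; last by rewrite tz tz'.
  apply: sqr_inj => //; apply: (addrI (d' ^+ 2)); apply: (addIr (t ^+ 2)).
  by rewrite e2 tz -tz' e2'.
have pp : p = p' by apply: (mulfI sN).
split=> //; apply: sqr_inj => //; apply: (addrI (d' ^+ 2 + p ^+ 2)).
by rewrite e2 pp e2'.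
Qed.

Lemma exists_normal_form x y : quat_dot x x = 1 -> quat_dot y y = 1 ->
  exists2 q, quat_dot q q = 1 & M_set u v (kappa q x, kappa q y).
Proof.
move=> xx yy.
have vu : quat_dot v u = 0 by rewrite quat_dotC.
(* The norm equations for the coordinates follow from those of [x] and [y],
   since rotations preserve the norm. *)
suff [q qq [c [s [d [p [t [[s0 t0 hs] e]]]]]]] :
    exists2 q, quat_dot q q = 1 & exists c s d p t,
    [/\ 0 <= s, 0 <= t & s = 0 -> 0 <= p /\ t = 0] /\
    (kappa q x, kappa q y) = normal_form u v c s d p t.
  exists q => //; rewrite e; apply: M_set_normal_form.
  have [_ _ _ e1 e2] := normal_form_invariants c s d p t.
  by split; rewrite // -?e1 -?e2 -e kappa_dot.
have [x' x1 xE] := quat_imagP x; have [y' y1 yE] := quat_imagP y.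
have kE q c z : quat_dot q q = 1 -> kappa q (c%:A + z) = c%:A + kappa q z.
  by move=> qq; rewrite kappaD kappaZ kappa_of1.
(* A real first component leaves the rotation free for the second. *)
have [xz|xN] := eqVneq x' 0.
  have [q qq [p p0 [qy _]]] := rotate_imag y1 u1 uu v1 vv vu.
  exists q => //; exists (quat_dot x 1), 0, (quat_dot y 1), p, 0; split=> //.
  by rewrite {1}xE {1}yE !kE// xz qy /normal_form -{1}(scale0r 0) kappaZ !scale0r !addr0.
have [q qq [s s0 [qx _]]] := rotate_imag x1 u1 uu v1 vv vu.
set p := quat_dot u (kappa q y'); set z := kappa q y' - p *: u.
have qy : kappa q y' = p *: u + z by rewrite addrC subrK.
have z1 : quat_dot z 1 = 0.
  by rewrite /z -scaleNr quat_dotDl quat_dotZl u1 mulr0 addr0 kappa_dot1.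
have uz : quat_dot u z = 0.
  by rewrite /z -scaleNr quat_dotDr quat_dotZr uu mulr1 subrr.
have [r rr [t t0 [rz /(_ uz) ru]]] := rotate_imag z1 v1 vv u1 uu uv.
exists (r * q); first by rewrite quat_dotM rr qq mulr1.
exists (quat_dot x 1), s, (quat_dot y 1), p, t; split; last first.
  by rewrite {1}xE {1}yE !kappaM !kE// qx qy kappaD !kappaZ rz ru /normal_form addrA.
split=> // sz; case/eqP: xN; apply: quat_dot_eq0.
by rewrite -(kappa_dot _ _ qq) qx sz scale0r /quat_dot /= mulr0 !addr0.
Qed.

Lemma M_set_S3 m : M_set u v m -> (S3 R `*` S3 R) m.
Proof.
move=> /M_set_normal_formP[c [s [d [p [t [[_ _ _ e1 e2] ->]]]]]].
have [_ _ _ n1 n2] := normal_form_invariants c s d p t.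
by split; apply/S3E; rewrite ?n1 ?n2.
Qed.

End OrthonormalPair.

End Main.

Theorem proposition6p1 (R : realType) (u v : quat R)
    (hu : orth1 R u) (hv : orth1 R v) (huv : orthonormal_pair u v) :
  action_transversal (@diag_act R) (SO3 R) (S3 R `*` S3 R) (M_set u v).
Proof.
case: huv => /S3E uu /S3E vv uv; split; first exact: M_set_S3.
move=> [x y] [/S3E xx /S3E yy].
have [q qq Mq] := exists_normal_form hu hv uu vv uv xx yy.
exists (kappa q x, kappa q y); split.
  by split=> //; exists (kappa q) => //; exists q => //; apply/S3E.
move=> m [Mm [_ [r /S3E rr <-] mE]]; rewrite -{m}mE /diag_act /= in Mm *.
apply: (M_set_inj hu hv uu vv uv) => //=.
- by rewrite !kappa_dot1.
- by rewrite !kappa_dot1.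
- by rewrite !kappa_dot.
Qed.
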